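(* Suppose that each $f_j$ is $\mathrm{diag}(m^j)$-smooth, where $m^j=(m_1^j,\dots,m_d^j)\in\mathbb R^d$ has positive entries. Consider the method RL (defined in the context) with stepsize $\alpha=\min_{i,j}\left(4\frac{m_i^j}{p_i}+\frac\sigma{r_j}\right)^{-1}$. Then its iteration complexity is $\max_{i,j}\left(4\frac{m_i^j}{\sigma p_i}+\frac1{r_j}\right)\log\frac1\epsilon$; that is, there exists $b\in\mathbb R^n$ with positive entries such that, with $$\Psi^k=\|x^k-x^*\|^2+\alpha\sum_{j=1}^n\sum_{i=1}^d\frac{b_j^2}{m_i^j}\left(\nabla_if_j(\phi_j^k)-\nabla_if_j(x^* )\right)^2,$$ for every $\epsilon\in(0,1)$ and every integer $k\ge\max_{i,j}\left(4\frac{m_i^j}{\sigma p_i}+\frac1{r_j}\right)\log\frac1\epsilon$ we have $\mathbb E[\Psi^k]\le\epsilon\,\Psi^0$.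
   Context: Problem. $f_1,\dots,f_n:\mathbb R^d\to\mathbb R$ are differentiable and convex, $f=\frac1n\sum_{j=1}^n f_j$, $\psi:\mathbb R^d\to\mathbb R\cup\{+\infty\}$ is proper, closed and convex. $\min_x f(x)+\psi(x)$ has a unique minimizer $x^*$, and $f$ is $\sigma$-quasi strongly convex with $\sigma>0$: $f(x^* )\ge f(y)+\langle\nabla f(y),x^*-y\rangle+\frac\sigma2\|y-x^*\|^2$ for all $y$. $\mathrm{diag}(m^j)$-smoothness of $f_j$ means $f_j(x)\le f_j(y)+\langle\nabla f_j(y),x-y\rangle+\frac12\sum_im_i^j(x_i-y_i)^2$ for all $x,y$. $\mathrm{prox}_{\alpha\psi}(x)=\arg\min_u\{\alpha\psi(u)+\frac12\|u-x\|^2\}$; $e_i$ is the $i$-th standard basis vector of $\mathbb R^d$; $\nabla_i$ denotes the $i$-th partial derivative. Samplings. $L\subseteq[d]$ and $R\subseteq[n]$ are random subsets with arbitrary distributions such that $p_i=\mathbb P(i\in L)>0$ for all $i\in[d]$ and $r_j=\mathbb P(j\in R)>0$ for all $j\in[n]$. Algorithm (RL). Given $x^0\in\mathbb R^d$, set $\phi_j^0=x^0$ for all $j$. For $k=0,1,2,\dots$: draw $R^k$ (copy of $R$) and $L^k$ (copy of $L$), independently of each other and of the past; set $\phi_j^{k+1}=x^k$ if $j\in R^k$ and $\phi_j^{k+1}=\phi_j^k$ otherwise; $g^k=\frac1n\sum_{j=1}^n\nabla f_j(\phi_j^k)+\sum_{i\in L^k}\frac1{p_i}\left(\nabla_if(x^k)-\frac1n\sum_{j=1}^n\nabla_if_j(\phi_j^k)\right)e_i$;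 $x^{k+1}=\mathrm{prox}_{\alpha\psi}(x^k-\alpha g^k)$. *)

(* Defs.v *)
From HB Require Import structures.
From mathcomp Require Import all_boot all_order all_algebra.
From mathcomp Require Import finmap.
From mathcomp Require Import all_classical all_reals all_analysis.

Set Implicit Arguments.
Unset Strict Implicit.
Unset Printing Implicit Defensive.

Import Order.TTheory GRing.Theory Num.Theory.
Import numFieldNormedType.Exports.

Local Open Scope classical_set_scope.
Local Open Scope ring_scope.

Section Optimization.
Context {R : realType} {d : nat}.
Implicit Types (x y u v : 'rV[R]_d) (g : 'rV[R]_d -> R) (psi : 'rV[R]_d -> \bar R).

(* The norm `| _ | of MathComp-Analysis on matrices is the sup norm, so the
   Euclidean inner product and squared norm are introduced separately; both
   norms induce the same topology and the same notion of differentiability. *)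
Definition dot u v : R := \sum_(i < d) u 0 i * v 0 i.
Definition sqnorm u : R := dot u u.

Definition std_basis (i : 'I_d) : 'rV[R]_d := delta_mx 0 i.

Definition partial (i : 'I_d) g x : R := 'D_(std_basis i) g x.
Definition grad g x : 'rV[R]_d := \row_i partial i g x.

Definition diag_smooth (m : 'rV[R]_d) g : Prop :=
  forall x y, g x <= g y + dot (grad g y) (x - y)
                     + 2^-1 * \sum_(i < d) m 0 i * (x 0 i - y 0 i) ^+ 2.

Definition quasi_strongly_convex (sigma : R) (xstar : 'rV[R]_d) g : Prop :=
  forall y, g xstar >= g y + dot (grad g y) (xstar - y)
                       + sigma / 2 * sqnorm (y - xstar).

Definition proper_function psi : Prop :=
  (forall x, psi x != -oo%E) /\ exists x, (psi x < +oo)%E.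

Definition closed_function psi : Prop :=
  closed [set z : 'rV[R]_d * R | (psi z.1 <= z.2%:E)%E].

(* The library's [convex_function] only covers real-valued functions. For a
   [psi] that never takes the value -oo the right-hand side below is never of
   the form +oo - oo, and 0 * +oo = 0 makes the cases t = 0, 1 trivial. *)
Definition ereal_convex psi : Prop :=
  forall x y (t : R), 0 <= t <= 1 ->
    (psi (t *: x + (1 - t) *: y)%R <= t%:E * psi x + (1 - t)%:E * psi y)%E.

Definition is_minimizer (F : 'rV[R]_d -> \bar R) u : Prop :=
  forall v, (F u <= F v)%E.

Definition unique_minimizer (F : 'rV[R]_d -> \bar R) u : Prop :=
  is_minimizer F u /\ forall v, is_minimizer F v -> v = u.

(* [xget x A] is an element of A, and the junk value x if A is empty. *)
Definition prox (alpha : R) psi x : 'rV[R]_d :=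
  xget x (is_minimizer
    (fun u => alpha%:E * psi u + (2^-1 * sqnorm (u - x))%:E)%E).

End Optimization.

Section Method.
Context {R : realType} {d n : nat}.
Variable f : 'I_n -> 'rV[R]_d -> R.

Definition favg (x : 'rV[R]_d) : R := n%:R^-1 * \sum_(j < n) f j x.

Definition rl_estimator (p : 'I_d -> R) (x : 'rV[R]_d) (phi : 'I_n -> 'rV[R]_d)
    (L : {set 'I_d}) : 'rV[R]_d :=
  n%:R^-1 *: (\sum_(j < n) grad (f j) (phi j))
  + \sum_(i in L)
      ((p i)^-1 * (partial i favg x
                   - n%:R^-1 * \sum_(j < n) partial i (f j) (phi j)))
      *: std_basis i.

(* The state of the method is the pair (x^k, (phi_j^k)_j). *)
Definition rl_state : Type := ('rV[R]_d * ('I_n -> 'rV[R]_d))%type.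

Definition rl_init (x0 : 'rV[R]_d) : rl_state := (x0, fun=> x0).

Definition rl_step (psi : 'rV[R]_d -> \bar R) (alpha : R) (p : 'I_d -> R)
    (L : {set 'I_d}) (J : {set 'I_n}) (s : rl_state) : rl_state :=
  (prox alpha psi (s.1 - alpha *: rl_estimator p s.1 s.2 L),
   fun j => if j \in J then s.1 else s.2 j).

Fixpoint rl_iter (psi : 'rV[R]_d -> \bar R) (alpha : R) (p : 'I_d -> R)
    (x0 : 'rV[R]_d) (L : nat -> {set 'I_d}) (J : nat -> {set 'I_n}) (k : nat)
    : rl_state :=
  if k is k'.+1 then
    rl_step psi alpha p (L k') (J k') (rl_iter psi alpha p x0 L J k')
  else rl_init x0.

Definition lyapunov (alpha : R) (m : 'I_n -> 'rV[R]_d) (b : 'rV[R]_n)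
    (xstar : 'rV[R]_d) (s : rl_state) : R :=
  sqnorm (s.1 - xstar)
  + alpha * \sum_(j < n) \sum_(i < d)
      b 0 j ^+ 2 / m j 0 i
      * (partial i (f j) (s.2 j) - partial i (f j) xstar) ^+ 2.

End Method.

Definition min_ij {R : realType} {d n : nat} (F : 'I_d.+1 -> 'I_n.+1 -> R) : R :=
  \big[Num.min/F ord0 ord0]_(i < d.+1) \big[Num.min/F i ord0]_(j < n.+1) F i j.

Definition max_ij {R : realType} {d n : nat} (F : 'I_d.+1 -> 'I_n.+1 -> R) : R :=
  \big[Num.max/F ord0 ord0]_(i < d.+1) \big[Num.max/F i ord0]_(j < n.+1) F i j.

Section Sampling.
Context {R : realType} {disp : measure_display} {T : measurableType disp}.
Variable P : probability T R.

(* Random subsets of [N] are measurable maps into the discrete space of all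
   subsets of [N]. *)
Definition random_subset {N : nat} (X : T -> {set 'I_N}) : Prop :=
  forall B : set {set 'I_N}, measurable (X @^-1` B).

Definition incl_prob {N : nat} (X : T -> {set 'I_N}) (i : 'I_N) : R :=
  fine (P [set w | i \in X w]).

Definition same_distribution {N : nat} (X Y : T -> {set 'I_N}) : Prop :=
  forall B : set {set 'I_N}, P (X @^-1` B) = P (Y @^-1` B).

Definition mutually_independent {I : choiceType} (F : I -> set_system T) : Prop :=
  forall (J : {fset I}) (E : I -> set T), (forall i, i \in J -> F i (E i)) ->
    P (\bigcap_(i in [set` J]) E i) = (\prod_(i <- J) fine (P (E i)))%:E.

Definition sigma_of {N : nat} (X : T -> {set 'I_N}) : set_system T :=
  preimage_set_system setT X [set: set {set 'I_N}].

Definition independent_samples {d n : nat}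
    (L : nat -> T -> {set 'I_d}) (J : nat -> T -> {set 'I_n}) : Prop :=
  mutually_independent (fun k : nat + nat =>
    match k with inl k => sigma_of (L k) | inr k => sigma_of (J k) end).

End Sampling.

(* Main.v *)
(** With h_j = grad f_j(phi_j), take
    b_j^2 = 1 / (2 n r_j) and show E[Psi^(k+1) | past] <= (1 - alpha sigma) Psi^k.
    Comparing the optimality of x^(k+1) in the proximal subproblem with that of
    x^* for f + psi bounds |x^(k+1) - x^*| by
    |x^k - x^* - alpha (g^k - grad f(x^* ))|. Taking expectations coordinatewise
    yields a cross term, controlled by quasi strong convexity and by the
    cocoercivity of each grad f_j, and a variance term, at most
    2 / p_i times the squared deviations of grad_i f(x^k) and of the mean of the
    h_j. The deviations at x^k are absorbed by cocoercivity, those of the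
    memory by the decrease (1 - r_j) of the second part of Psi; both need only
    alpha (4 m_i^j / p_i + sigma / r_j) <= 1. *)

Require Import Defs.
From HB Require Import structures.
From mathcomp Require Import all_boot all_order all_algebra.
From mathcomp Require Import finmap.
From mathcomp Require Import all_classical all_reals all_analysis.
From mathcomp Require Import measurable_realfun ring lra.

Set Implicit Arguments.
Unset Strict Implicit.
Unset Printing Implicit Defensive.

Import Order.TTheory GRing.Theory Num.Theory.
Import numFieldNormedType.Exports.

Local Open Scope classical_set_scope.
Local Open Scope ring_scope.

(** * The Euclidean inner product: bilinearity, coordinate bounds, continuity *)

Section Euclidean.
Context {R : realType} {d : nat}.
Implicit Types u v w : 'rV[R]_d.

Lemma dotC u v : dot u v = dot v u.
Proof. by apply: eq_bigr => i _; rewrite mulrC. Qed.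

Lemma dotDl u v w : dot (u + v) w = dot u w + dot v w.
Proof. by rewrite /dot -big_split; apply: eq_bigr => i _; rewrite mxE mulrDl. Qed.

Lemma dotZl (a : R) u v : dot (a *: u) v = a * dot u v.
Proof. by rewrite /dot mulr_sumr; apply: eq_bigr => i _; rewrite mxE mulrA. Qed.

Lemma dotNl u v : dot (- u) v = - dot u v.
Proof. by rewrite -scaleN1r dotZl mulN1r. Qed.

Lemma dotDr u v w : dot u (v + w) = dot u v + dot u w.
Proof. by rewrite dotC dotDl !(dotC u). Qed.

Lemma dotZr (a : R) u v : dot u (a *: v) = a * dot u v.
Proof. by rewrite dotC dotZl dotC. Qed.

Lemma dotNr u v : dot u (- v) = - dot u v.
Proof. by rewrite dotC dotNl dotC. Qed.

Definition dotE := (dotDl, dotDr, dotNl, dotNr, dotZl, dotZr).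

Lemma sqnorm_ge0 u : 0 <= sqnorm u.
Proof. by apply: sumr_ge0 => i _; rewrite -expr2 sqr_ge0. Qed.

Lemma sqr_coord_le_sqnorm u i : u 0 i ^+ 2 <= sqnorm u.
Proof.
rewrite /sqnorm /dot (bigD1 i)//= -expr2 lerDl.
by apply: sumr_ge0 => j _; rewrite -expr2 sqr_ge0.
Qed.

Lemma sqnorm_continuous (x : 'rV[R]_d) : continuous (fun u => sqnorm (u - x)).
Proof.
apply: continuous_big => [|i _ u]; first exact: (@add_continuous R^o).
have cx : {for u, continuous (fun v : 'rV[R]_d => (v - x) 0 i)}.
  have -> : (fun v : 'rV[R]_d => (v - x) 0 i) = (fun v => v 0 i - x 0 i).
    by apply/funext => v; rewrite !mxE.
  by apply: continuousB; [exact: coord_continuous|exact: cst_continuous].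
exact: continuousM.
Qed.

End Euclidean.

(** * First-order inequalities for convex functions and for minimizers *)

Section FirstOrder.
Context {R : realType} {d : nat}.
Implicit Types (u v w x y : 'rV[R]_d) (g : 'rV[R]_d -> R).

Lemma derive_dot_grad g u v : differentiable g u -> 'D_v g u = dot (grad g u) v.
Proof.
move=> gu; rewrite deriveE// [in LHS](row_sum_delta v) raddf_sum /dot.
apply: eq_bigr => i _.
by rewrite [LHS](linearZ_LR ('d g u)) mxE /partial deriveE// mulrC.
Qed.

(** The derivative is the limit of its right difference quotients, and each quotient at [t] in (0,
    1] is at least [c]. *)
Lemma ge_derive_of_secants g u w (c : R) : derivable g u w ->
  (forall t, 0 < t <= 1 -> t * c <= g (t *: w + u) - g u) -> c <= 'D_w g u.
Proof.
move=> gd H.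
have : (fun h => h^-1 *: ((g \o shift u) (h *: w) - g u)) @ 0^'+ --> 'D_w g u.
  exact: cvg_dnbhs_at_right gd.
move=> /[dup] /cvgP cv /cvg_lim <-//.
apply: limr_ge => //; near=> t.
have t0 : 0 < t by near: t; exact: nbhs_right_gt.
have t1 : t <= 1 by near: t; exact: nbhs_right_le.
by rewrite [_ *: _]mulrC ler_pdivlMr// mulrC; apply: H; rewrite t0 t1.
Unshelve. all: by end_near.
Qed.

Lemma convex_functionP g : convex_function setT g -> forall x y (t : R),
  0 <= t <= 1 -> g (t *: x + (1 - t) *: y) <= t * g x + (1 - t) * g y.
Proof.
move=> gc x y t /andP[t0 t1].
have tI : Itv.spec (@Itv.num_sem R) (Itv.Real `[0%Z, 1%Z]) t.
  by apply/and3P; split; rewrite ?num_real ?bnd_simp//.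
by have := gc (Itv.mk tI) x y (in_setT _) (in_setT _).
Qed.

(** Convexity bounds the secant slopes from above by [g y - g x], so [ge_derive_of_secants] is
    applied to [- g]. *)
Lemma convex_ge_tangent g x y : convex_function setT g -> differentiable g x ->
  g x + dot (grad g x) (y - x) <= g y.
Proof.
move=> /convex_functionP gc gx; rewrite -derive_dot_grad// -lerBrDl -lerN2.
rewrite -deriveN; last exact: diff_derivable.
apply: ge_derive_of_secants => [|t /andP[t0 t1]].
  by apply: derivableN; exact: diff_derivable.
have := gc y x t; rewrite (ltW t0) t1 => /(_ erefl).
have -> : t *: y + (1 - t) *: x = t *: (y - x) + x.
  by apply/rowP => i; rewrite !mxE; ring.
rewrite !opprfctE /= => H; lra.
Qed.

(** Cocoercivity in Bregman form: the value of [g] at [x - D] lies above the tangent at [y] and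
    below the quadratic smoothness bound at [x]. *)
Lemma bregman_ge (m : 'rV[R]_d) g x y : (forall i, 0 < m 0 i) ->
  convex_function setT g -> (forall z, differentiable g z) -> diag_smooth m g ->
  2^-1 * (\sum_i (partial i g x - partial i g y) ^+ 2 / m 0 i)
    <= g x - g y - dot (grad g y) (x - y).
Proof.
move=> m0 gc gd gs.
(* This [D] minimizes the gap between the quadratic bound at [x] and the tangent at [y], hence gives
   the strongest inequality. *)
pose D : 'rV[R]_d := \row_i ((partial i g x - partial i g y) / m 0 i).
have := convex_ge_tangent (x - D) gc (gd y).
have := gs (x - D) x.
have -> : x - D - x = - D by apply/rowP => i; rewrite !mxE; ring.
have -> : x - D - y = x - y - D by apply/rowP => i; rewrite !mxE; ring.
have -> : \sum_i m 0 i * ((x - D) 0 i - x 0 i) ^+ 2 =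
    \sum_i (partial i g x - partial i g y) ^+ 2 / m 0 i.
  apply: eq_bigr => i _; rewrite !mxE; field; exact: lt0r_neq0.
have : dot (grad g x) D - dot (grad g y) D =
    \sum_i (partial i g x - partial i g y) ^+ 2 / m 0 i.
  rewrite /dot -sumrB; apply: eq_bigr => i _; rewrite !mxE.
  field; exact: lt0r_neq0.
rewrite !dotE; lra.
Qed.

Variable psi : 'rV[R]_d -> \bar R.
Hypotheses (psi_proper : proper_function psi) (psi_convex : ereal_convex psi).

Lemma ereal_convex_fin u v (a b t : R) : psi u = a%:E -> psi v = b%:E ->
  0 <= t <= 1 -> (psi (t *: (v - u) + u) <= (t * b + (1 - t) * a)%:E)%E.
Proof.
move=> pu pv t01; have := psi_convex v u t01; rewrite pu pv -!EFinM -EFinD.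
congr (psi _ <= _)%E.
by apply/rowP => i; rewrite !mxE; ring.
Qed.

Lemma minimizer_fin g u :
  is_minimizer (fun x => (g x)%:E + psi x)%E u -> exists a : R, psi u = a%:E.
Proof.
move=> umin; case: psi_proper => psiN [v pv]; have := umin v.
have := psiN u; case: (psi u) => [a| |]//; first by exists a.
by move=> _; rewrite addey// leye_eq; case: (psi v) pv => [b| |]//.
Qed.

(** First-order optimality: [- grad g u] is a subgradient of [psi] at [u]. Moving a fraction [t]
    towards [v] raises [psi] by at most [t * (b - a)], so minimality forces [g] to rise by at least
    [t * (a - b)]. *)
Lemma minimizer_subgradient g u v (a b : R) : differentiable g u ->
  is_minimizer (fun x => (g x)%:E + psi x)%E u ->
  psi u = a%:E -> psi v = b%:E -> a <= b + dot (grad g u) (v - u).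
Proof.
move=> gu umin pu pv; rewrite -derive_dot_grad// -lerBlDl.
apply: ge_derive_of_secants => [|t /andP[t0 t1]]; first exact: diff_derivable.
have t01 : 0 <= t <= 1 by rewrite ltW.
have := le_trans (umin _) (leeD2l _ (ereal_convex_fin pu pv t01)).
rewrite pu -!EFinD lee_fin; lra.
Qed.

Lemma ge0_of_pos_perturbation (a c : R) :
  (forall t, 0 < t <= 1 -> 0 <= a + t * c) -> 0 <= a.
Proof.
move=> H; rewrite leNgt; apply/negP => a0.
have N0 : 0 < `|c| - a by rewrite -[ltLHS]addr0 ler_ltD// oppr_gt0.
(* If [a < 0], this [t] keeps [t * c] at most [- a / 2], so [a + t * c] is at most [a / 2], which is
   negative. *)
have /H : 0 < - a / (2 * (`|c| - a)) <= 1.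
  rewrite divr_gt0 ?oppr_gt0 ?mulr_gt0//= ler_pdivrMr ?mulr_gt0//.
  have := normr_ge0 c; lra.
have : - a / (2 * (`|c| - a)) * c <= - a / 2.
  rewrite invfM mulrA -mulrA ler_piMr ?divr_ge0 ?oppr_ge0 ?ltW//.
  rewrite mulrC ltr_pdivrMr// mul1r; have := ler_norm c; lra.
lra.
Qed.

(** The vector [alpha^-1 *: (x - u)] is a subgradient of [psi] at the proximal point [u]. Comparing
    [u] with [t *: (v - u) + u] and dividing by [t] leaves an error of order [t]. *)
Lemma prox_minimizer_variational (alpha : R) x u v (a b : R) :
  is_minimizer (fun w => alpha%:E * psi w + (2^-1 * sqnorm (w - x))%:E)%E u ->
  0 < alpha ->
  psi u = a%:E -> psi v = b%:E -> alpha * a <= alpha * b + dot (u - x) (v - u).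
Proof.
move=> umin al0 pu pv; rewrite -subr_ge0.
apply: (@ge0_of_pos_perturbation _ (2^-1 * sqnorm (v - u))) => t /andP[t0 t1].
have t01 : 0 <= t <= 1 by rewrite ltW.
have := umin (t *: (v - u) + u).
have := ereal_convex_fin pu pv t01.
have al0E : (0 <= alpha%:E)%E by rewrite lee_fin ltW.
move=> /(lee_wpmul2l al0E); rewrite pu.
move=> /(leeD2r (2^-1 * sqnorm (t *: (v - u) + u - x))%:E) H1 H2.
have := le_trans H2 H1; rewrite -!EFinM -!EFinD lee_fin.
have -> : t *: (v - u) + u - x = t *: (v - u) + (u - x) by rewrite addrA.
move: (v - u) (u - x) => w z; rewrite /sqnorm !dotE (dotC w z) => H.
have : 0 <= t * (alpha * b + dot z w - alpha * a + t * (2^-1 * dot w w)) by lra.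
by rewrite pmulr_rge0//; lra.
Qed.

End FirstOrder.

(** * The proximal operator: existence and nonexpansiveness *)

Section Prox.
Context {R : realType} {d : nat}.
Variable psi : 'rV[R]_d -> \bar R.
Hypotheses (psi_proper : proper_function psi) (psi_closed : closed_function psi).
Variables (xs g : 'rV[R]_d) (a alpha : R).
Hypotheses (psi_xs : psi xs = a%:E) (alpha_gt0 : 0 < alpha).
Hypothesis psi_minorant :
  forall v (b : R), psi v = b%:E -> a <= b + dot g (v - xs).

(* Completing the square: with z = x + alpha g, the affine minorant of psi
   confines the sublevel set {v | obj v <= obj xs} to the ball of centre z
   through xs. *)
Lemma prox_sublevel_bounded x v (b : R) : psi v = b%:E ->
  alpha * b + 2^-1 * sqnorm (v - x) <= alpha * a + 2^-1 * sqnorm (xs - x) ->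
  let z := x + alpha *: g in
  [/\ sqnorm (v - z) <= sqnorm (xs - z),
      b <= a + alpha^-1 * (2^-1 * sqnorm (xs - x)) &
      a - (2^-1 * sqnorm g + 2 * sqnorm (xs - z)) <= b].
Proof.
move=> pv H z.
have Hb := psi_minorant pv.
have Hab : alpha * a <= alpha * b + alpha * dot g (v - xs).
  by rewrite -mulrDr ler_pM2l.
have H1 : sqnorm (v - z) <= sqnorm (xs - z).
  move: H Hab; rewrite /z.
  have -> : v - (x + alpha *: g) = (v - xs) + ((xs - x) - alpha *: g).
    by apply/rowP => i; rewrite !mxE; ring.
  have -> : v - x = (v - xs) + (xs - x) by apply/rowP => i; rewrite !mxE; ring.
  have -> : xs - (x + alpha *: g) = (xs - x) - alpha *: g.
    by apply/rowP => i; rewrite !mxE; ring.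
  move: (v - xs) (xs - x) => p q.
  by rewrite /sqnorm !dotE (dotC q p) (dotC g p) (dotC g q); lra.
split=> //.
  rewrite -lerBlDl ler_pdivlMl//.
  by have := sqnorm_ge0 (v - x); lra.
(* Lower bound on [b]: Young's inequality for [dot g (v - xs)], with the squared norm of [v - xs] at
   most four times that of [xs - z]. *)
have : 0 <= sqnorm (g - (v - xs)) := sqnorm_ge0 _.
have : 0 <= sqnorm ((v - z) + (xs - z)) := sqnorm_ge0 _.
have : sqnorm (v - xs) = sqnorm ((v - z) - (xs - z)).
  by congr sqnorm; apply/rowP => i; rewrite !mxE; ring.
move: H1 Hb; move: (v - xs) (v - z) (xs - z) => p q r.
by rewrite /sqnorm !dotE (dotC p g) (dotC r q); lra.
Qed.

(** As [psi] is only lower semicontinuous and may be infinite, the continuous function [F] of a pair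
    (point, height) is minimized instead, over the closed epigraph cut down to a compact box. *)
Lemma prox_exists x :
  exists u, is_minimizer
    (fun w => alpha%:E * psi w + (2^-1 * sqnorm (w - x))%:E)%E u.
Proof.
pose obj w : \bar R := (alpha%:E * psi w + (2^-1 * sqnorm (w - x))%:E)%E.
(* Since [s <= (1 + s) ^+ 2] for [s >= 0], this radius encloses the sublevel ball without a square
   root. *)
pose z := x + alpha *: g; pose rho := 1 + sqnorm (xs - z).
pose B := [set v : 'rV[R]_d | forall i,
  `[z 0 i - rho, z 0 i + rho]%classic (v 0 i)].
pose tmin := a - (2^-1 * sqnorm g + 2 * sqnorm (xs - z)).
pose tmax := a + alpha^-1 * (2^-1 * sqnorm (xs - x)).
pose epi := [set y : 'rV[R]_d * R | (psi y.1 <= y.2%:E)%E].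
pose K := (B `*` `[tmin, tmax]%classic) `&` epi.
pose F := fun y : 'rV[R]_d * R => alpha * y.2 + 2^-1 * sqnorm (y.1 - x).
have inK v (b : R) : psi v = b%:E -> F (v, b) <= F (xs, a) -> K (v, b).
  move=> pv /(prox_sublevel_bounded pv)[H1 H2 H3]; split; last first.
    by rewrite /epi /= pv.
  split; last by rewrite /= in_itv /= H2 H3.
  move=> i /=; rewrite in_itv /=.
  have := le_trans (sqr_coord_le_sqnorm (v - z) i) H1.
  rewrite !mxE => H.
  have : `|v 0 i - (x 0 i + alpha * g 0 i)| <= rho.
    rewrite -ler_sqr ?nnegrE// ?real_normK ?num_real//; last first.
      by rewrite addr_ge0// sqnorm_ge0.
    rewrite (le_trans H)// /rho.
    have := sqnorm_ge0 (xs - z); rewrite /z; nra.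
  by rewrite ler_norml => /andP[? ?]; apply/andP; split; lra.
have K0 : K !=set0 by exists (xs, a); exact: inK.
have cK : compact K.
  apply: compact_closedI => //; apply: compact_setX; last exact: segment_compact.
  apply: (@rV_compact _ _ (fun i => `[z 0 i - rho, z 0 i + rho]%classic)) => i.
  exact: segment_compact.
have cF : continuous F.
  move=> y; apply: cvgD; apply: cvgM; [exact: cvg_cst|exact: cvg_snd
    |exact: cvg_cst|].
  apply: (cvg_comp _ (fun w => sqnorm (w - x)) (cvg_fst (T := 'rV[R]_d))).
  exact: sqnorm_continuous.
have [[u t] /set_mem[_ /= epi_ut] Fmin] :=
  compact_EVT_min K0 cK (continuous_subspaceT cF).
have obj_u : (obj u <= (F (u, t))%:E)%E.
  by rewrite /obj /F EFinD leeD2r// EFinM lee_wpmul2l// lee_fin ltW.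
exists u => v; apply: le_trans obj_u _.
rewrite /obj; have := psi_proper.1 v; case pv : (psi v) => [b| |]// _.
  rewrite -EFinM -EFinD lee_fin; change (F (u, t) <= F (v, b)).
  (* A pair with a larger value than [(xs, a)] may lie outside [K]; it is then compared with
     [(xs, a)], which is in [K]. *)
  have [/(inK _ _ pv) Kvb|/ltW] := leP (F (v, b)) (F (xs, a)).
    by apply: Fmin; exact: mem_set.
  apply: le_trans; apply: Fmin; apply: mem_set; exact: inK.
by rewrite gt0_muley ?lte_fin// addye// leey.
Qed.

Hypothesis psi_convex : ereal_convex psi.

(** By [psi_minorant], [xs] is itself the proximal point of [xs - alpha *: g], so this is
    nonexpansiveness: add the minorant at the new point to its variational inequality tested at
    [xs]. *)
Lemma prox_contraction y :
  sqnorm (prox alpha psi (y - alpha *: g) - xs) <= sqnorm (y - xs).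
Proof.
set x := y - _.
(* Existence rules out the junk value of [xget]. *)
have umin : is_minimizer
    (fun w => alpha%:E * psi w + (2^-1 * sqnorm (w - x))%:E)%E
    (prox alpha psi x).
  by have := xgetPex x (prox_exists x).
move: (prox alpha psi x) umin => u umin.
have [b pu] : exists b : R, psi u = b%:E.
  have := umin xs; have := psi_proper.1 u; rewrite psi_xs.
  case: (psi u) => [b| |]//; first by exists b.
  by rewrite gt0_muley ?lte_fin// addye.
have := prox_minimizer_variational psi_convex umin alpha_gt0 pu psi_xs.
have := psi_minorant pu.
rewrite -(ler_pM2l alpha_gt0) mulrDr.
have -> : u - x = (u - xs) - (y - xs) + alpha *: g.
  by apply/rowP => i; rewrite !mxE; ring.
have -> : xs - u = - (u - xs) by apply/rowP => i; rewrite !mxE; ring.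
have : 0 <= sqnorm ((u - xs) - (y - xs)) := sqnorm_ge0 _.
move: (u - xs) (y - xs) => p q.
by rewrite /sqnorm !dotE (dotC q p); lra.
Qed.

End Prox.

(** * Moments of one sampled coordinate *)

Section FiniteSampling.
Context {R : realType} {N : nat}.
Variables (q : {set 'I_N} -> R) (i : 'I_N).
Hypothesis q_sum1 : \sum_A q A = 1.
Let p := \sum_(A : {set 'I_N} | i \in A) q A.

Lemma sampled_mean (a c : R) :
  \sum_A q A * (a + (if i \in A then c else 0)) = a + p * c.
Proof.
under eq_bigr do rewrite mulrDr (fun_if ( *%R _)) mulr0.
by rewrite big_split /= -mulr_suml q_sum1 mul1r -big_mkcond /= mulr_suml.
Qed.

(** The estimator has mean [a], so the cross term is exact. Its second moment falls short of the
    bound by [(p^-1 - 1) * (a + h) ^+ 2 + a ^+ 2 + 2 * h ^+ 2], nonnegative because [p <= 1]. *)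
Lemma sampled_quadratic_le (X a h alpha : R) : 0 < p <= 1 ->
  \sum_A q A * (X - alpha * (h + (if i \in A then p^-1 * (a - h) else 0))) ^+ 2
  <= X ^+ 2 - 2 * alpha * (X * a)
     + alpha ^+ 2 * (2 / p * a ^+ 2 + 2 / p * h ^+ 2).
Proof.
move=> /andP[p0 p1].
pose c := (X - alpha * (h + p^-1 * (a - h))) ^+ 2 - (X - alpha * h) ^+ 2.
under eq_bigr => A _.
  have -> : (X - alpha * (h + (if i \in A then p^-1 * (a - h) else 0))) ^+ 2 =
      (X - alpha * h) ^+ 2 + (if i \in A then c else 0).
    by rewrite /c; case: ifP => _; ring.
  over.
rewrite sampled_mean /c.
have -> : (X - alpha * h) ^+ 2 +
    p * ((X - alpha * (h + p^-1 * (a - h))) ^+ 2 - (X - alpha * h) ^+ 2) =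
    X ^+ 2 - 2 * alpha * (X * a)
     + alpha ^+ 2 * (2 / p * a ^+ 2 + 2 / p * h ^+ 2)
     - alpha ^+ 2 * ((p^-1 - 1) * (a + h) ^+ 2 + a ^+ 2 + 2 * h ^+ 2).
  by field; exact: lt0r_neq0.
have ip0 : 0 <= p^-1 - 1 by rewrite subr_ge0 invf_ge1.
rewrite gerBl; apply: mulr_ge0; first exact: sqr_ge0.
have := mulr_ge0 ip0 (sqr_ge0 (a + h)).
by have := sqr_ge0 a; have := sqr_ge0 h; lra.
Qed.

End FiniteSampling.

(** Nonnegativity of the variance of [a] about its mean [c]. *)
Lemma sqr_mean_le {R : realType} (n : nat) (a : 'I_n.+1 -> R) :
  (n.+1%:R^-1 * \sum_j a j) ^+ 2 <= n.+1%:R^-1 * \sum_j a j ^+ 2.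
Proof.
set c := _ * \sum_j a j.
have n0 : n.+1%:R != 0 :> R by rewrite pnatr_eq0.
have cE : \sum_j a j = n.+1%:R * c by rewrite /c mulrA mulfV// mul1r.
have : 0 <= \sum_j (a j - c) ^+ 2 by apply: sumr_ge0 => j _; exact: sqr_ge0.
have -> : \sum_j (a j - c) ^+ 2 = \sum_j (a j ^+ 2 - (2 * c) * a j + c ^+ 2).
  by apply: eq_bigr => j _; ring.
rewrite big_split /= sumrB -mulr_sumr cE sumr_const card_ord -mulr_natl => H.
by rewrite ler_pdivlMl ?ltr0n//; lra.
Qed.

(** * One step of RL contracts the Lyapunov function in expectation *)

Section Step.
Context {R : realType} {d n : nat}.
Variables (f : 'I_n.+1 -> 'rV[R]_d -> R) (psi : 'rV[R]_d -> \bar R).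
Variables (xstar : 'rV[R]_d) (sigma : R) (m : 'I_n.+1 -> 'rV[R]_d).
Hypotheses (sigma_gt0 : 0 < sigma) (fdiff : forall j x, differentiable (f j) x)
  (fconv : forall j, convex_function setT (f j))
  (psi_proper : proper_function psi) (psi_closed : closed_function psi)
  (psi_convex : ereal_convex psi)
  (xstar_min : is_minimizer (fun x => (favg f x)%:E + psi x)%E xstar)
  (fqsc : quasi_strongly_convex sigma xstar (favg f))
  (m_gt0 : forall j i, 0 < m j 0 i)
  (fsmooth : forall j, diag_smooth (m j) (f j)).

Lemma favgE : favg f = n.+1%:R^-1 \*: (\sum_(j < n.+1) f j).
Proof. by apply/funext => x; rewrite /favg /= fct_sumE. Qed.

Lemma differentiable_favg x : differentiable (favg f) x.
Proof. by rewrite favgE; apply: differentiableZ; exact: differentiable_sum. Qed.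

Lemma partial_favg i x :
  partial i (favg f) x = n.+1%:R^-1 * \sum_(j < n.+1) partial i (f j) x.
Proof.
rewrite favgE /partial deriveZ; last first.
  by apply: diff_derivable; exact: differentiable_sum.
by rewrite derive_sum// => j; exact: diff_derivable.
Qed.

Lemma rl_estimatorE p x phi (A : {set 'I_d}) i :
  rl_estimator f p x phi A 0 i = n.+1%:R^-1 * \sum_j partial i (f j) (phi j) +
    (if i \in A then (p i)^-1 * (partial i (favg f) x
       - n.+1%:R^-1 * \sum_j partial i (f j) (phi j)) else 0).
Proof.
rewrite /rl_estimator !mxE !summxE; congr (_ * _ + _).
  by apply: eq_bigr => j _; rewrite mxE.
rewrite big_mkcond (bigD1 i)//= [X in _ + X]big1 => [|k /negPf ki].
  by rewrite addr0; case: ifP => // _; rewrite !mxE !eqxx mulr1.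
by case: ifP => // _; rewrite !mxE eqxx eq_sym ki mulr0.
Qed.

Variables (q : {set 'I_d} -> R) (rho : {set 'I_n.+1} -> R).
Hypotheses (q_ge0 : forall A, 0 <= q A) (q_sum1 : \sum_A q A = 1).
Hypothesis rho_sum1 : \sum_B rho B = 1.
Let p i := \sum_(A : {set 'I_d} | i \in A) q A.
Let r j := \sum_(B : {set 'I_n.+1} | j \in B) rho B.
Hypotheses (p_gt0 : forall i, 0 < p i) (r_gt0 : forall j, 0 < r j).
Variable alpha : R.
Hypotheses (alpha_gt0 : 0 < alpha)
  (alpha_le : forall i j, alpha * (4 * (m j 0 i / p i) + sigma / r j) <= 1).

Lemma incl_weight_le1 i : p i <= 1.
Proof.
by rewrite /p -q_sum1 [leRHS](bigID (fun A : {set 'I_d} => i \in A))/= lerDl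
  sumr_ge0.
Qed.

Let a x j i := partial i (f j) x - partial i (f j) xstar.
Let N := n.+1%:R : R.

Lemma mean_partial_sub (F : 'I_n.+1 -> 'rV[R]_d) i :
  N^-1 * \sum_j partial i (f j) (F j) - N^-1 * \sum_j partial i (f j) xstar
  = N^-1 * \sum_j a (F j) j i.
Proof. by rewrite -mulrBr -sumrB. Qed.

(** Subtracting the gradient at [xstar] from the estimator is compensated by [prox_contraction]; the
    rest separates over coordinates, each handled by [sampled_quadratic_le]. *)
Lemma expected_distance_le x phi :
  \sum_A q A * sqnorm (prox alpha psi (x - alpha *: rl_estimator f p x phi A)
                       - xstar)
  <= \sum_i ((x - xstar) 0 i ^+ 2
       - 2 * alpha * ((x - xstar) 0 i * (N^-1 * \sum_j a x j i))
       + alpha ^+ 2 * (2 / p i * (N^-1 * \sum_j a x j i) ^+ 2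
                       + 2 / p i * (N^-1 * \sum_j a (phi j) j i) ^+ 2)).
Proof.
have [c psi_xs] := minimizer_fin psi_proper xstar_min.
have minorant v b : psi v = b%:E -> c <= b + dot (grad (favg f) xstar) (v - xstar).
  exact: (minimizer_subgradient psi_convex (differentiable_favg _)).
pose g := grad (favg f) xstar.
pose e A := rl_estimator f p x phi A - g.
have eE A i : e A 0 i = N^-1 * (\sum_j a (phi j) j i) +
    (if i \in A then (p i)^-1 * (N^-1 * (\sum_j a x j i)
       - N^-1 * \sum_j a (phi j) j i) else 0).
  rewrite /e mxE rl_estimatorE [(- g) 0 i]mxE [g 0 i]mxE.
  rewrite [partial i (favg f) xstar]partial_favg.
  rewrite partial_favg -(mean_partial_sub phi) -(mean_partial_sub (fun=> x)) -/N.
  by case: ifP => _; ring.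
apply: (@le_trans _ _ (\sum_A q A * sqnorm (x - alpha *: e A - xstar))).
  apply: ler_sum => A _; apply: ler_wpM2l => //.
  have -> : x - alpha *: rl_estimator f p x phi A =
      (x - alpha *: e A) - alpha *: g.
    by apply/rowP => i; rewrite !mxE; ring.
  exact: (prox_contraction psi_proper psi_closed psi_xs).
under eq_bigr do rewrite mulr_sumr.
rewrite exchange_big /=; apply: ler_sum => i _.
apply: le_trans; last first.
  by apply: (@sampled_quadratic_le _ _ q); rewrite ?p_gt0 ?incl_weight_le1.
apply: ler_sum => A _; apply: ler_wpM2l => //.
have coordE (w : 'rV[R]_d) :
    (x - alpha *: w - xstar) 0 i = (x - xstar) 0 i - alpha * w 0 i.
  by rewrite !mxE; ring.
by rewrite -expr2 coordE eE.
Qed.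

Lemma expected_memoryE (b : 'rV[R]_n.+1) x phi :
  \sum_B rho B * (alpha * \sum_j \sum_i b 0 j ^+ 2 / m j 0 i
      * a (if j \in B then x else phi j) j i ^+ 2)
  = alpha * \sum_j \sum_i b 0 j ^+ 2 / m j 0 i
      * (r j * a x j i ^+ 2 + (1 - r j) * a (phi j) j i ^+ 2).
Proof.
under eq_bigr do rewrite mulrCA mulr_sumr.
rewrite -mulr_sumr exchange_big /=; congr (_ * _); apply: eq_bigr => j _.
under eq_bigr do rewrite mulr_sumr.
rewrite exchange_big /=; apply: eq_bigr => i _.
set w := _ / _; set u := a x j i ^+ 2; set v := a (phi j) j i ^+ 2.
(* Old value plus the increment incurred when [j] is sampled, the shape of [sampled_mean]. *)
have -> : w * (r j * u + (1 - r j) * v) = w * v + r j * (w * (u - v)) by ring.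
rewrite -(sampled_mean _ rho_sum1); apply: eq_bigr => B _; congr (_ * _).
by rewrite /u /v; case: ifP => _; ring.
Qed.

(** Add quasi strong convexity at [x] to the average of [bregman_ge] between [x] and [xstar]: the
    function values cancel. *)
Lemma quasi_strong_convexity_bregman x :
  sigma * sqnorm (x - xstar)
    + \sum_j \sum_i N^-1 * (a x j i ^+ 2 / m j 0 i)
  <= 2 * \sum_i (x - xstar) 0 i * (N^-1 * \sum_j a x j i).
Proof.
have -> : \sum_i (x - xstar) 0 i * (N^-1 * \sum_j a x j i) =
    dot (grad (favg f) x - grad (favg f) xstar) (x - xstar).
  apply: eq_bigr => i _; rewrite mulrC; congr (_ * _).
  rewrite mxE [(- grad _ _) 0 i]mxE [grad _ x 0 i]mxE [grad _ xstar 0 i]mxE.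
  by rewrite !partial_favg -(mean_partial_sub (fun=> x)).
have gE y : dot (grad (favg f) y) (x - xstar) =
    N^-1 * \sum_j dot (grad (f j) y) (x - xstar).
  rewrite /dot exchange_big /= mulr_sumr; apply: eq_bigr => i _.
  rewrite [grad _ y 0 i]mxE partial_favg -mulrA mulr_suml; congr (_ * _).
  by apply: eq_bigr => j _; rewrite [grad _ y 0 i]mxE.
have H j : \sum_i a x j i ^+ 2 / m j 0 i <=
    2 * (f j x - f j xstar - dot (grad (f j) xstar) (x - xstar)).
  by rewrite -ler_pdivrMl//; exact: bregman_ge.
have N_ge0 : 0 <= N^-1 by rewrite invr_ge0 ler0n.
have : N^-1 * \sum_j \sum_i a x j i ^+ 2 / m j 0 i <=
    N^-1 * (2 * (\sum_j f j x - \sum_j f j xstar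
                 - \sum_j dot (grad (f j) xstar) (x - xstar))).
  by rewrite -!sumrB; apply: ler_wpM2l => //; rewrite mulr_sumr; apply: ler_sum.
have -> : \sum_j \sum_i N^-1 * (a x j i ^+ 2 / m j 0 i) =
    N^-1 * \sum_j \sum_i a x j i ^+ 2 / m j 0 i.
  by rewrite mulr_sumr; apply: eq_bigr => j _; rewrite mulr_sumr.
rewrite dotDl dotNl.
have := fqsc x; rewrite -opprB dotNr [dot (grad _ xstar) _]gE /favg -/N.
by move: (N^-1) => iN; lra.
Qed.

Variable b : 'rV[R]_n.+1.
Hypothesis b_sqr : forall j, b 0 j ^+ 2 = (2 * N * r j)^-1.

(** With this [b], refreshing the memory costs half of the cocoercivity gain in [u ^+ 2]; the other
    half pays for the variance when [4 * e1 <= 1]. The [v ^+ 2] terms balance when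
    [4 * e1 + e2 <= 1], which is the stepsize condition. *)
Lemma coefficient_balance j i (u v : R) :
  - alpha * (N^-1 * (u ^+ 2 / m j 0 i))
  + alpha ^+ 2 * (2 / p i * (N^-1 * u ^+ 2) + 2 / p i * (N^-1 * v ^+ 2))
  + alpha * (b 0 j ^+ 2 / m j 0 i * (r j * u ^+ 2 + (1 - r j) * v ^+ 2))
  <= (1 - alpha * sigma) * (alpha * (b 0 j ^+ 2 / m j 0 i * v ^+ 2)).
Proof.
pose K := alpha / (2 * N * r j * m j 0 i).
have N0 : 0 < N by rewrite ltr0n.
have K0 : 0 <= K.
  by apply: divr_ge0; [exact: ltW|rewrite !mulr_ge0// ltW].
pose e1 := alpha * (m j 0 i / p i); pose e2 := alpha * (sigma / r j).
have e12 : 4 * e1 + e2 <= 1.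
  by have := alpha_le i j; rewrite /e1 /e2; lra.
have -> : alpha * sigma = e2 * r j by rewrite /e2; field; exact: lt0r_neq0.
rewrite b_sqr -subr_ge0.
have -> : (1 - e2 * r j) * (alpha * ((2 * N * r j)^-1 / m j 0 i * v ^+ 2)) -
  (- alpha * (N^-1 * (u ^+ 2 / m j 0 i))
  + alpha ^+ 2 * (2 / p i * (N^-1 * u ^+ 2) + 2 / p i * (N^-1 * v ^+ 2))
  + alpha * ((2 * N * r j)^-1 / m j 0 i * (r j * u ^+ 2 + (1 - r j) * v ^+ 2)))
  = K * (r j * ((1 - 4 * e1) * u ^+ 2 + (1 - 4 * e1 - e2) * v ^+ 2)).
  by rewrite /K /e1 /e2; field; rewrite !lt0r_neq0.
have e2_ge0 : 0 <= 1 - 4 * e1 - e2 by lra.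
have e1_ge0 : 0 <= 1 - 4 * e1.
  by rewrite -(subrK e2 (1 - _)) addr_ge0// /e2 mulr_ge0 ?divr_ge0 ?ltW.
apply: mulr_ge0 => //; apply: mulr_ge0; first exact: ltW.
by apply: addr_ge0; apply: mulr_ge0 => //; exact: sqr_ge0.
Qed.

Lemma expected_lyapunov_step_le s :
  \sum_A \sum_B q A * rho B
    * lyapunov f alpha m b xstar (rl_step f psi alpha p A B s)
  <= (1 - alpha * sigma) * lyapunov f alpha m b xstar s.
Proof.
case: s => x phi; pose e A := rl_estimator f p x phi A.
pose U (A : {set 'I_d}) := sqnorm (prox alpha psi (x - alpha *: e A) - xstar).
pose V (B : {set 'I_n.+1}) := alpha * \sum_j \sum_i b 0 j ^+ 2 / m j 0 i
      * a (if j \in B then x else phi j) j i ^+ 2.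
(* The new point depends on [A] alone and the new memory on [B] alone, so under the product law the
   expectation splits. *)
have -> : \sum_A \sum_B q A * rho B
    * lyapunov f alpha m b xstar (rl_step f psi alpha p A B (x, phi))
    = \sum_A q A * U A + \sum_B rho B * V B.
  transitivity (\sum_A (q A * U A + q A * \sum_B rho B * V B)).
    apply: eq_bigr => A _.
    rewrite -[U A]mul1r -rho_sum1 mulr_suml -mulrDr -big_split mulr_sumr.
    by apply: eq_bigr => B _ /=; rewrite -mulrA; congr (_ * _); rewrite -mulrDr.
  by rewrite big_split /= -mulr_suml q_sum1 mul1r.
rewrite /V expected_memoryE.
apply: le_trans (lerD (expected_distance_le x phi) (lexx _)) _.
have := quasi_strong_convexity_bregman x.
rewrite -(ler_pM2l alpha_gt0) => qsc.
rewrite /lyapunov /=.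
set X := x - xstar in qsc *.
(* Quasi strong convexity supplies the factor on [sqnorm X]; all remaining terms are grouped by
   [(j, i)] so that [coefficient_balance] applies termwise. *)
apply: (@le_trans _ _ ((1 - alpha * sigma) * sqnorm X + \sum_j \sum_i
  (- alpha * (N^-1 * (a x j i ^+ 2 / m j 0 i))
  + alpha ^+ 2 * (2 / p i * (N^-1 * a x j i ^+ 2)
                  + 2 / p i * (N^-1 * a (phi j) j i ^+ 2))
  + alpha * (b 0 j ^+ 2 / m j 0 i
     * (r j * a x j i ^+ 2 + (1 - r j) * a (phi j) j i ^+ 2))))); last first.
  rewrite mulrDr lerD2l !mulr_sumr; apply: ler_sum => j _.
  rewrite !mulr_sumr; apply: ler_sum => i _.
  exact: coefficient_balance.
(* Jensen's inequality turns squared means into means of squares, making the variance separable in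
   [j]. *)
have H : \sum_i alpha ^+ 2 * (2 / p i * (N^-1 * \sum_j a x j i) ^+ 2
                       + 2 / p i * (N^-1 * \sum_j a (phi j) j i) ^+ 2)
   <= \sum_j \sum_i alpha ^+ 2 * (2 / p i * (N^-1 * a x j i ^+ 2)
                  + 2 / p i * (N^-1 * a (phi j) j i ^+ 2)).
  rewrite exchange_big /=; apply: ler_sum => i _.
  rewrite -mulr_sumr; apply: ler_wpM2l; first exact: sqr_ge0.
  rewrite [leRHS]big_split /= -!mulr_sumr.
  by apply: lerD; apply: ler_wpM2l; [rewrite divr_ge0 ?ltW|exact: sqr_mean_le
    |rewrite divr_ge0 ?ltW|exact: sqr_mean_le].
have -> : \sum_i (X 0 i ^+ 2 - 2 * alpha * (X 0 i * (N^-1 * \sum_j a x j i))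
       + alpha ^+ 2 * (2 / p i * (N^-1 * \sum_j a x j i) ^+ 2
                       + 2 / p i * (N^-1 * \sum_j a (phi j) j i) ^+ 2)) =
    sqnorm X - 2 * alpha * (\sum_i X 0 i * (N^-1 * \sum_j a x j i))
    + \sum_i alpha ^+ 2 * (2 / p i * (N^-1 * \sum_j a x j i) ^+ 2
                       + 2 / p i * (N^-1 * \sum_j a (phi j) j i) ^+ 2).
  by rewrite big_split /= sumrB -mulr_sumr.
have -> : \sum_j \sum_i (- alpha * (N^-1 * (a x j i ^+ 2 / m j 0 i))
  + alpha ^+ 2 * (2 / p i * (N^-1 * a x j i ^+ 2)
                  + 2 / p i * (N^-1 * a (phi j) j i ^+ 2))
  + alpha * (b 0 j ^+ 2 / m j 0 i
     * (r j * a x j i ^+ 2 + (1 - r j) * a (phi j) j i ^+ 2))) =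
  - alpha * (\sum_j \sum_i N^-1 * (a x j i ^+ 2 / m j 0 i))
  + \sum_j \sum_i alpha ^+ 2 * (2 / p i * (N^-1 * a x j i ^+ 2)
                  + 2 / p i * (N^-1 * a (phi j) j i ^+ 2))
  + alpha * \sum_j \sum_i b 0 j ^+ 2 / m j 0 i
     * (r j * a x j i ^+ 2 + (1 - r j) * a (phi j) j i ^+ 2).
  rewrite !mulr_sumr -!big_split; apply: eq_bigr => j _.
  by rewrite !mulr_sumr -!big_split.
by move: H qsc; rewrite -/N; lra.
Qed.

End Step.

(** * Expectations along a recursion driven by i.i.d. finitely valued noise *)

Section RandomRecursion.
Context {R : realType} {disp : measure_display} {T : measurableType disp}.
Variables (P : probability T R) (E : finType) (X : nat -> T -> E) (mu : E -> R).
Hypotheses (X_meas : forall l e, measurable (X l @^-1` [set e]))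
  (mu_ge0 : forall e, 0 <= mu e)
  (X_iid : forall K (e : nat -> E),
    P [set w | forall l, (l < K)%N -> X l w = e l]
    = (\prod_(0 <= l < K) mu (e l))%:E).
Variables (S : Type) (step : E -> S -> S) (s0 : S) (state : nat -> T -> S).
Hypotheses (state0 : forall w, state 0 w = s0)
  (stateS : forall k w, state k.+1 w = step (X k w) (state k w)).

(** The first [k] noise values determine the state, so it takes finitely many values and arbitrary
    [Q] are allowed; the induction splits on the last noise value. *)
Lemma measurable_state k (Q : set S) : measurable [set w | Q (state k w)].
Proof.
elim: k Q => [|k IH] Q.
  under eq_fun do rewrite state0.
  have [q|q] := pselect (Q s0).
    by rewrite (_ : [set _ | _] = setT)//; apply/seteqP; split.
  by rewrite (_ : [set _ | _] = set0)//; apply/seteqP; split.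
rewrite (_ : [set _ | _] = \bigcup_(e in [set: E])
    (X k @^-1` [set e] `&` [set w | Q (step e (state k w))])).
  apply: fin_bigcup_measurable => [|e _]; first exact: finite_finset.
  by apply: measurableI; [exact: X_meas|exact: (IH (fun s => Q (step e s)))].
apply/seteqP; split=> w /=; rewrite stateS.
  by move=> ?; exists (X k w).
by case=> e _ [/= <-].
Qed.

Lemma measurable_fun_state k (V : S -> R) D : measurable D ->
  measurable_fun D (EFin \o (fun w => V (state k w))).
Proof.
move=> mD _ Y _; apply: measurableI => //.
exact: (measurable_state k (fun s => Y (V s)%:E)).
Qed.

Let cyl k K (e : nat -> E) :=
  [set w | forall l, (k <= l < K)%N -> X l w = e l].

Lemma measurable_cylinder k K e : measurable (cyl k K e).
Proof.
rewrite (_ : cyl k K e =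
    \bigcap_(l in [set l | (k <= l < K)%N]) X l @^-1` [set e l]).
  by apply: bigcap_measurableType => l _; exact: X_meas.
by apply/seteqP; split=> w.
Qed.

(** The Markov operator of the recursion. *)
Definition transition (V : S -> R) (s : S) := \sum_e mu e * V (step e s).

Lemma iter_transition_sum k (F : E -> S -> R) s :
  iter k transition (fun s => \sum_e mu e * F e s) s
  = \sum_e mu e * iter k transition (F e) s.
Proof.
elim: k F s => [//|k IH] F s; rewrite iterSr.
have -> : transition (fun s => \sum_e mu e * F e s)
    = fun s => \sum_e mu e * transition (F e) s.
  apply/funext => t; rewrite /transition.
  under eq_bigr do rewrite mulr_sumr.
  rewrite exchange_big; apply: eq_bigr => e _ /=; rewrite mulr_sumr.
  by apply: eq_bigr => e' _; rewrite mulrCA.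
by rewrite IH; apply: eq_bigr => e _; rewrite iterSr.
Qed.

(* Restricting to a prescribed future X_k, ..., X_(K-1) makes the induction on
   k go through using only finite products of probabilities. *)
Lemma integral_state_cylinder K k (V : S -> R) (e : nat -> E) :
  (forall s, 0 <= V s) -> (k <= K)%N ->
  (\int[P]_(w in cyl k K e) (V (state k w))%:E)%E
  = (\prod_(k <= l < K) mu (e l) * iter k transition V s0)%:E.
Proof.
elim: k V e => [|k IH] V e V0 kK.
  under eq_integral do rewrite state0.
  rewrite integral_cst; last exact: measurable_cylinder.
  by rewrite EFinM muleC; congr (_ * _)%E; exact: X_iid.
(* The cylinder starting at [k.+1] is the disjoint union over [x] of cylinders starting at [k] with
   [X k = x]; on each piece the new state is [step x] of the old one. *)
pose upd (x : E) l := if l == k then x else e l.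
have cylE : cyl k.+1 K e = \big[setU/set0]_(x <- index_enum E) cyl k K (upd x).
  rewrite -bigcup_seq; apply/seteqP; split=> w /=.
    move=> H; exists (X k w); first exact: mem_index_enum.
    move=> l /andP[kl lK]; rewrite /upd; case: eqP => [->//|/eqP nlk].
    by apply: H; rewrite lK andbT ltn_neqAle eq_sym nlk.
  case=> x _ H l /andP[kl lK]; rewrite H ?lK ?(ltnW kl)//.
  by rewrite /upd gtn_eqF.
have Xk x w : cyl k K (upd x) w -> X k w = x.
  by move/(_ k); rewrite leqnn kK => /(_ erefl); rewrite /upd eqxx.
have mcyl := measurable_cylinder.
rewrite [X in (\int[P]_(w in X) _)%E]cylE ge0_integral_bigsetU//; last 4 first.
- exact: index_enum_uniq.
- by move=> x y _ _ [w [/= /Xk <- /Xk <-]].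
- by apply: measurable_fun_state; apply: bigsetU_measurable.
- by move=> w _; rewrite lee_fin.
transitivity (\sum_(x : E) (\prod_(k.+1 <= l < K) mu (e l) *
    (mu x * iter k transition (V \o step x) s0))%:E)%E.
  apply: eq_bigr => x _.
  rewrite (eq_integral (fun w => ((V \o step x) (state k w))%:E)).
    rewrite IH ?(ltnW kK)//; last by move=> s; exact: V0.
    rewrite big_ltn// [in mu _]/upd eqxx mulrCA -!mulrA; congr (_ * (_ * _))%:E.
    by apply: eq_big_nat => l /andP[kl _]; rewrite /upd gtn_eqF.
  by move=> w /set_mem /Xk; rewrite /= stateS => ->.
rewrite sumEFin -mulr_sumr iterSr.
by congr (_ * _)%:E; rewrite -iter_transition_sum.
Qed.

Lemma expectation_state_le (V : S -> R) (c : R) k :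
  (forall s, 0 <= V s) -> 0 <= c ->
  (forall s, transition V s <= c * V s) ->
  ('E_P[fun w => V (state k w)] <= (c ^+ k * V s0)%:E)%E.
Proof.
(* A dummy noise value for the empty cylinder [cyl k k]; it exists because total mass 1 makes [T]
   nonempty. *)
move=> V0 c0 Vc; have [e0] : inhabited E.
  have [w _] : [set: T] !=set0.
    by apply/set0P/eqP => TE; have := probability_setT P; rewrite TE measure0 => /eqP;
      rewrite eqe eq_sym oner_eq0.
  by constructor; exact: (X 0 w).
have := integral_state_cylinder (fun=> e0) V0 (leqnn k).
rewrite big_geq// mul1r (_ : cyl k k _ = setT); last first.
  by apply/seteqP; split=> // w _ l; rewrite ltnNge; case: leqP.
rewrite unlock => ->; rewrite lee_fin.
elim: k s0 => [|k IH] s /=; first by rewrite mul1r.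
apply: le_trans (_ : _ <= transition (fun s => c ^+ k * V s) s) _.
  by apply: ler_sum => e _; apply: ler_wpM2l.
rewrite /transition; under eq_bigr do rewrite mulrCA.
rewrite -mulr_sumr exprSr -mulrA; apply: ler_wpM2l; first exact: exprn_ge0.
exact: Vc.
Qed.

End RandomRecursion.

(** * Laws of random subsets and their joint law under independence *)

Section SubsetSampling.
Context {R : realType} {disp : measure_display} {T : measurableType disp}.
Variable P : probability T R.

Definition subset_law {N : nat} (X : T -> {set 'I_N}) (A : {set 'I_N}) : R :=
  fine (P (X @^-1` [set A])).

Lemma subset_law_ge0 N (X : T -> {set 'I_N}) A : 0 <= subset_law X A.
Proof. exact: fine_ge0. Qed.

Lemma prob_preim_subset_law N (X : T -> {set 'I_N}) (Q : pred {set 'I_N}) :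
  random_subset X -> fine (P [set w | Q (X w)]) = \sum_(A | Q A) subset_law X A.
Proof.
move=> mX.
have -> : [set w | Q (X w)] = \bigcup_(A in [set` Q]) X @^-1` [set A].
  apply/seteqP; split=> w /=; first by move=> QX; exists (X w).
  by case=> A QA /= ->.
rewrite measure_fin_bigcup; [|exact: finite_finset
  |by move=> A B _ _ [w [/= -> ->]]|by move=> A _; exact: mX].
rewrite -(@bigfs _ _ _ _ (index_enum {set 'I_N})) ?index_enum_uniq//;
  last by move=> A _; rewrite mem_index_enum.
rewrite (eq_bigr (fun A => (subset_law X A)%:E)) ?sumEFin// => A _.
by rewrite fineK// fin_num_measure//; exact: mX.
Qed.

Lemma subset_law_sum1 N (X : T -> {set 'I_N}) :
  random_subset X -> \sum_A subset_law X A = 1.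
Proof.
move=> mX; rewrite -(@prob_preim_subset_law _ _ predT)//=.
by rewrite (_ : [set _ | _] = setT) ?probability_setT//; apply/seteqP; split.
Qed.

Lemma incl_prob_subset_law N (X : T -> {set 'I_N}) i : random_subset X ->
  incl_prob P X i = \sum_(A : {set 'I_N} | i \in A) subset_law X A.
Proof. by move=> mX; rewrite -(@prob_preim_subset_law _ _ (fun A => i \in A)). Qed.

Lemma independent_samples_joint_law d n
    (L : nat -> T -> {set 'I_d}) (J : nat -> T -> {set 'I_n}) K
    (e : nat -> {set 'I_d} * {set 'I_n}) :
  independent_samples P L J ->
  P [set w | forall l, (l < K)%N -> (L l w, J l w) = e l] =
  (\prod_(0 <= l < K) (subset_law (L l) (e l).1 * subset_law (J l) (e l).2))%:E.
Proof.
move=> indep.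
(* Mutual independence is applied to the first [K] draws of both families, with singleton events. *)
pose s : seq (nat + nat) := map inl (iota 0 K) ++ map inr (iota 0 K).
have us : uniq s.
  rewrite cat_uniq !map_inj_uniq ?iota_uniq//; last 2 first.
  - by move=> ? ? [].
  - by move=> ? ? [].
  by rewrite andbT; apply/hasPn => _ /mapP[l _ ->]; apply/mapP => -[].
pose F (k : nat + nat) : set T := match k with
  | inl k => L k @^-1` [set (e k).1]
  | inr k => J k @^-1` [set (e k).2]
  end.
have [K' K's K'P] : exists2 K' : {fset nat + nat}, K' =i s & perm_eq K' s.
  exists (seq_fset tt s); first exact: seq_fsetE.
  by rewrite -{2}(undup_id us) seq_fset_perm.
have := indep K' F.
rewrite (perm_big _ K'P) big_cat !big_map /= -big_split /index_iota /= subn0 => <-;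
  last by move=> [k|k] _; eexists => //; rewrite setTI.
congr (P _); apply/seteqP; split=> w /= H.
  move=> [l|l] /=; rewrite K's mem_cat => /orP[] /mapP[k] //;
    by rewrite mem_iota add0n => /H /[swap] -[->] <-.
move=> l lK; rewrite [RHS]surjective_pairing; congr (_, _).
  by apply: (H (inl l)); rewrite /= K's mem_cat map_f ?mem_iota.
by apply: (H (inr l)); rewrite /= K's mem_cat orbC map_f ?mem_iota.
Qed.

End SubsetSampling.

(** * Extrema over index pairs, the geometric rate and the complexity bound *)

Lemma min_ij_attained (R : realType) d n (F : 'I_d.+1 -> 'I_n.+1 -> R) :
  exists i j, min_ij F = F i j.
Proof.
rewrite /min_ij.
(* The default values of both nested minima are entries of [F], so the minimum is an entry. *)
have inner i : exists j, \big[Num.min/F i ord0]_(j < n.+1) F i j = F i j.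
  elim/big_ind: _ => [|x y [j1 ->] [j2 ->]|j _]; [by exists ord0| |by exists j].
  by rewrite /Num.min; case: ifP; [exists j1|exists j2].
elim/big_ind: _ => [|x y [i1 [j1 ->]] [i2 [j2 ->]]|i _].
- by exists ord0, ord0.
- by rewrite /Num.min; case: ifP; [exists i1, j1|exists i2, j2].
- by have [j ->] := inner i; exists i, j.
Qed.

Lemma min_ij_le (R : realType) d n (F : 'I_d.+1 -> 'I_n.+1 -> R) i j :
  min_ij F <= F i j.
Proof. by apply: le_trans; [exact: (bigmin_le _ i)|exact: bigmin_le]. Qed.

Lemma max_ij_ge (R : realType) d n (F : 'I_d.+1 -> 'I_n.+1 -> R) i j :
  F i j <= max_ij F.
Proof. by apply: le_trans; last exact: (le_bigmax _ _ i); exact: le_bigmax. Qed.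

(** Uses [1 - c <= expR (- c)] and compares exponents. *)
Lemma geometric_le_eps (R : realType) (c eps : R) k :
  0 < c <= 1 -> 0 < eps -> c^-1 * ln (1 / eps) <= k%:R -> (1 - c) ^+ k <= eps.
Proof.
move=> /andP[c0 c1] e0; rewrite div1r lnV ?posrE// ler_pdivrMl// => H.
apply: (@le_trans _ _ (expR (- c) ^+ k)).
  by apply: lerXn2r; rewrite ?nnegrE ?subr_ge0 ?expR_ge0// expR_ge1Dx.
rewrite -expRM_natl -[leRHS](lnK _) ?posrE// ler_expR; lra.
Qed.

Theorem corollaryL1 (R : realType) (d n : nat)
  (* the optimization problem, in dimension d.+1 with n.+1 functions *)
  (f : 'I_n.+1 -> 'rV[R]_d.+1 -> R) (psi : 'rV[R]_d.+1 -> \bar R)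
  (xstar : 'rV[R]_d.+1) (sigma : R) (m : 'I_n.+1 -> 'rV[R]_d.+1)
  (fdiff : forall j x, differentiable (f j) x)
  (fconv : forall j, convex_function setT (f j))
  (psi_proper : proper_function psi) (psi_closed : closed_function psi)
  (psi_convex : ereal_convex psi)
  (xstar_min : unique_minimizer (fun x => (favg f x)%:E + psi x)%E xstar)
  (sigma_gt0 : 0 < sigma)
  (fqsc : quasi_strongly_convex sigma xstar (favg f))
  (m_gt0 : forall j i, 0 < m j 0 i)
  (fsmooth : forall j, diag_smooth (m j) (f j))
  (* the samplings: L and J are the model random subsets,
     Lk k and Jk k their copies drawn at iteration k *)
  (disp : measure_display) (T : measurableType disp) (P : probability T R)
  (L : T -> {set 'I_d.+1}) (J : T -> {set 'I_n.+1})
  (Lk : nat -> T -> {set 'I_d.+1}) (Jk : nat -> T -> {set 'I_n.+1})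
  (L_random : random_subset L) (J_random : random_subset J)
  (Lk_random : forall k, random_subset (Lk k))
  (Jk_random : forall k, random_subset (Jk k))
  (Lk_copy : forall k, same_distribution P (Lk k) L)
  (Jk_copy : forall k, same_distribution P (Jk k) J)
  (LJ_indep : independent_samples P Lk Jk)
  (L_gt0 : forall i, 0 < incl_prob P L i)
  (J_gt0 : forall j, 0 < incl_prob P J j)
  (x0 : 'rV[R]_d.+1) :
  let p := incl_prob P L in
  let r := incl_prob P J in
  let alpha := min_ij (fun i j => (4 * (m j 0 i / p i) + sigma / r j)^-1) in
  let state := fun k w =>
    rl_iter f psi alpha p x0 (fun l => Lk l w) (fun l => Jk l w) k in
  exists b : 'rV[R]_n.+1, (forall j, 0 < b 0 j) /\
    forall (eps : R) (k : nat), 0 < eps < 1 ->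
      max_ij (fun i j => 4 * (m j 0 i / (sigma * p i)) + (r j)^-1)
        * ln (1 / eps) <= k%:R ->
      ('E_P[fun w => lyapunov f alpha m b xstar (state k w)]
       <= (eps * lyapunov f alpha m b xstar (rl_init x0))%:E)%E.
Proof.
move=> p r alpha state.
have pE i : p i = \sum_(A : {set 'I_d.+1} | i \in A) subset_law P L A.
  exact: incl_prob_subset_law.
have rE j : r j = \sum_(B : {set 'I_n.+1} | j \in B) subset_law P J B.
  exact: incl_prob_subset_law.
have step_gt0 i j : 0 < 4 * (m j 0 i / p i) + sigma / r j.
  by rewrite addr_gt0// ?mulr_gt0// ?invr_gt0 ?L_gt0 ?J_gt0.
have [i0 [j0 alphaE]] :
    exists i j, alpha = (4 * (m j 0 i / p i) + sigma / r j)^-1.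
  exact: min_ij_attained.
have alpha_gt0 : 0 < alpha by rewrite alphaE invr_gt0.
have alpha_le i j : alpha * (4 * (m j 0 i / p i) + sigma / r j) <= 1.
  rewrite -ler_pdivlMr// div1r.
  exact: (min_ij_le (fun i j => (4 * (m j 0 i / p i) + sigma / r j)^-1)).
pose b : 'rV[R]_n.+1 := \row_j Num.sqrt (2 * n.+1%:R * r j)^-1.
have b_gt0 j : 0 < b 0 j.
  by rewrite mxE sqrtr_gt0 invr_gt0 !mulr_gt0// J_gt0.
have b_sqr j : b 0 j ^+ 2 = (2 * n.+1%:R * r j)^-1.
  by rewrite mxE sqr_sqrtr// invr_ge0 !mulr_ge0// ltW// J_gt0.
exists b; split => // eps k /andP[eps_gt0 eps_lt1] k_ge.
pose V := lyapunov f alpha m b xstar.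
have V_ge0 s : 0 <= V s.
  apply: addr_ge0; first exact: sqnorm_ge0.
  apply: mulr_ge0; first exact: ltW.
  apply: sumr_ge0 => j _; apply: sumr_ge0 => i _.
  by rewrite mulr_ge0 ?sqr_ge0// divr_ge0 ?sqr_ge0 ?ltW.
(* Since [r j <= 1], the stepsize bound on [sigma / r j] also bounds [sigma]; this makes the
   contraction factor nonnegative. *)
have as_le1 : alpha * sigma <= 1.
  have := alpha_le ord0 ord0; rewrite mulrDr => H.
  have : alpha * (4 * (m ord0 0 ord0 / p ord0)) >= 0.
    by rewrite !mulr_ge0 ?invr_ge0 ?ltW ?L_gt0.
  have : alpha * sigma <= alpha * (sigma / r ord0).
    rewrite ler_pM2l//; apply: ler_peMr; first exact: ltW.
    rewrite invf_ge1 ?J_gt0// rE.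
    exact: (incl_weight_le1 (subset_law_ge0 P J) (subset_law_sum1 P J_random)).
  lra.
have rate : (1 - alpha * sigma) ^+ k <= eps.
  apply: geometric_le_eps => //; first by rewrite mulr_gt0.
  apply: le_trans k_ge; rewrite ler_wpM2r//.
    by rewrite ln_ge0// div1r invf_ge1// ltW.
  (* At the pair [(i0, j0)] defining the stepsize, the inverse of [alpha * sigma] is exactly an
     entry of the maximum. *)
  rewrite invfM alphaE invrK.
  apply: le_trans (max_ij_ge _ i0 j0); rewrite le_eqVlt; apply/orP; left.
  apply/eqP; field; rewrite !lt0r_neq0// ?L_gt0 ?J_gt0//.
(* The noise of one iteration is the pair of sampled sets, with product law. *)
pose mu (e : {set 'I_d.+1} * {set 'I_n.+1}) :=
  subset_law P L e.1 * subset_law P J e.2.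
pose step (e : {set 'I_d.+1} * {set 'I_n.+1}) :=
  rl_step f psi alpha p e.1 e.2.
have X_meas l (e : {set 'I_d.+1} * {set 'I_n.+1}) :
    measurable ((fun w => (Lk l w, Jk l w)) @^-1` [set e]).
  rewrite (_ : _ @^-1` _ = (Lk l @^-1` [set e.1]) `&` (Jk l @^-1` [set e.2])).
    by apply: measurableI; [exact: Lk_random|exact: Jk_random].
  by case: e => A B; apply/seteqP; split=> w /= [-> ->].
have X_iid K (e : nat -> {set 'I_d.+1} * {set 'I_n.+1}) :
    P [set w | forall l, (l < K)%N -> (Lk l w, Jk l w) = e l]
    = (\prod_(0 <= l < K) mu (e l))%:E.
  rewrite independent_samples_joint_law//; congr (_%:E).
  apply: eq_bigr => l _.
  by rewrite /mu /subset_law (Lk_copy l [set _]) (Jk_copy l [set _]).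
have mu_ge0 e : 0 <= mu e by rewrite mulr_ge0 ?subset_law_ge0.
have contraction s :
    transition mu step V s <= (1 - alpha * sigma) * V s.
  rewrite /transition -(pair_bigA _ (fun A B =>
    mu (A, B) * V (step (A, B) s)))/=.
  have pfun : p = fun i => \sum_(A : {set 'I_d.+1} | i \in A) subset_law P L A.
    by apply/funext.
  rewrite /mu /step /= pfun.
  apply: expected_lyapunov_step_le => //.
  - exact: xstar_min.1.
  - exact: subset_law_ge0.
  - exact: subset_law_sum1.
  - exact: subset_law_sum1.
  - by move=> i; rewrite -pE; exact: L_gt0.
  - by move=> j; rewrite -rE; exact: J_gt0.
  - by move=> i j; rewrite -pE -rE; exact: alpha_le.
  - by move=> j; rewrite -rE.
apply: le_trans (expectation_state_le X_meas mu_ge0 X_iid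
  (s0 := rl_init x0) (step := step) (state := state) _ _ k V_ge0 _ contraction) _.
- by [].
- by [].
- by rewrite subr_ge0.
by rewrite lee_fin; apply: ler_wpM2r.
Qed.
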